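(* Let $A$ be a non-empty finite set of positive integers and let $B$ be a finite subset of $\mathbb{Z}$ with $0\in B$ and $\min(A)+\min(B)\ge 0$. Then ${\rm M}(A,B)$ is a submonoid of $(\mathbb{N},+)$.
   Context: $\mathbb{N}$ denotes the non-negative integers. An $(A,B)$-sequence is a list $(x_1,\ldots,x_n)$ of odd finite length $n\geq 1$ such that $x_1,x_3,\ldots,x_n\in A$ and $x_2,x_4,\ldots,x_{n-1}\in B$. Put $|(x_1,\ldots,x_n)|=x_1+\cdots+x_n$ and ${\rm M}(A,B)=\{|x| : x \text{ is an } (A,B)\text{-sequence}\}\cup\{0\}$. *)

(* Defs.v *)
From mathcomp Require Export all_boot all_order all_algebra.
From mathcomp Require Export finmap.
From mathcomp Require Export boolp classical_sets.

Set Implicit Arguments.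
Unset Strict Implicit.
Unset Printing Implicit Defensive.

Import Order.TTheory GRing.Theory Num.Theory.
Local Open Scope ring_scope.

(* The default value [head 0 A] is an element of [A] as soon as [A] is
   nonempty, so it does not affect the minimum (see the two lemmas below);
   the minimum of the empty set is set to 0. *)
Definition fset_min (A : {fset int}) : int :=
  \big[Order.min/head 0 (enum_fset A)]_(a <- enum_fset A) a.

Lemma fset_min_le (A : {fset int}) (a : int) : a \in A -> fset_min A <= a.
Proof. by move=> aA; apply: (@ge_bigmin_seq _ _ _ _ _ a xpredT id). Qed.

Lemma fset_min_mem (A : {fset int}) (a : int) : a \in A -> fset_min A \in A.
Proof.
move=> aA; rewrite /fset_min.
have hA : head 0 (enum_fset A) \in A.
  rewrite -nth0; apply: (@mem_nth _ 0 (enum_fset A)).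
  by rewrite cardfs_gt0; apply/fset0Pn; exists a.
rewrite big_seq; elim/big_ind: _ => // x y xA yA.
by rewrite /Order.min; case: ifP.
Qed.

(* Positions are numbered from 0 here, so the entries at even positions
   are those numbered x_1, x_3, ..., x_n when counting from 1. *)
Definition AB_sequence (A B : {fset int}) (x : seq int) : Prop :=
  odd (size x) /\
  forall i : nat, (i < size x)%N -> nth 0 x i \in if odd i then B else A.

Definition seq_weight (x : seq int) : int := \sum_(a <- x) a.

Definition M (A B : {fset int}) : set int :=
  ([set seq_weight x | x in AB_sequence A B] `|` [set 0])%classic.

(* For a set of integers, being a submonoid of (N, +) includes being
   contained in N; [Posz @^-1` S] is then [S] viewed as a subset of [nat]. *)
Definition nat_submonoid (S : set int) : Prop :=
  (S `<=` range Posz)%classic /\ GRing.nmod_closed (mem (Posz @^-1` S)%classic).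

(* Main.v *)
Require Import Defs.
From mathcomp Require Import all_boot all_order all_algebra finmap.
From mathcomp Require Import boolp classical_sets.
Import Order.TTheory GRing.Theory Num.Theory.
Local Open Scope ring_scope.

(* Grouping a sequence as (x_1 + x_2) + ... + (x_(n-2) + x_(n-1)) + x_n shows
   that its weight is nonnegative, and since 0 lies in B, two sequences x and y
   can be joined into (x, 0, y), whose weight is |x| + |y|. *)

Lemma AB_sequence_cons2 (A B : {fset int}) (a b : int) (s : seq int) :
  AB_sequence A B [:: a, b & s] -> [/\ a \in A, b \in B & AB_sequence A B s].
Proof.
move=> [/= odd_s mem_s]; rewrite negbK in odd_s.
split; [exact: (mem_s 0%N) | exact: (mem_s 1%N) |].
by split=> // i lt_i; have := mem_s i.+2 lt_i; rewrite /= negbK.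
Qed.

Lemma AB_sequence_weight_ge0 (A B : {fset int}) (s : seq int) :
    {in A, forall a : int, 0 <= a} -> 0 <= fset_min A + fset_min B ->
  AB_sequence A B s -> 0 <= seq_weight s.
Proof.
(* Strong induction on the length, since each step removes two entries; odd length excludes the
   empty list. *)
move=> A_ge0 minAB; have [n] := ubnP (size s).
elim: n s => // n IHn [|a [|b s]] /= lt_n; first by case.
  by case=> _ /(_ 0%N isT) /A_ge0 a_ge0; rewrite /seq_weight big_seq1.
case/AB_sequence_cons2 => aA bB ABs; rewrite /seq_weight !big_cons addrA.
apply: addr_ge0; last by apply: IHn ABs; exact: ltnW lt_n.
by apply: le_trans minAB _; apply: lerD; apply: fset_min_le.
Qed.

(** As [s] has odd length, [b] lands at an odd position and [t] starts at an even one, so each entry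
    of [t] keeps the parity of its position. *)
Lemma AB_sequence_cat (A B : {fset int}) (b : int) (s t : seq int) :
    b \in B -> AB_sequence A B s -> AB_sequence A B t ->
  AB_sequence A B (s ++ b :: t).
Proof.
move=> bB [odd_s mem_s] [odd_t mem_t]; split.
  by rewrite size_cat oddD /= odd_s odd_t.
move=> i; rewrite size_cat nth_cat; case: (ltnP i (size s)) => [lt_i _|le_i].
  exact: mem_s.
(* Write [i] as [size s] plus an offset: offset 0 is [b], and offset [j.+1] is position [j] of
   [t]. *)
rewrite -(subnKC le_i) ltn_add2l addKn oddD odd_s.
by case: (i - size s)%N => [|j] //= lt_j; rewrite negbK; exact: mem_t.
Qed.

Lemma M_ge0 (A B : {fset int}) (z : int) :
    {in A, forall a : int, 0 <= a} -> 0 <= fset_min A + fset_min B ->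
  M A B z -> 0 <= z.
Proof.
by move=> A_ge0 minAB [[s ABs <-]|->//]; exact: AB_sequence_weight_ge0 ABs.
Qed.

Lemma M_add (A B : {fset int}) (y z : int) :
  0 \in B -> M A B y -> M A B z -> M A B (y + z).
Proof.
(* A summand equal to the adjoined 0 comes with no sequence to join, so it is absorbed as neutral
   element. *)
move=> B_0 [[s ABs <-]|->]; last by rewrite add0r.
move=> [[t ABt <-]|->]; last by rewrite addr0; left; exists s.
left; exists (s ++ 0 :: t); first exact: AB_sequence_cat.
by rewrite /seq_weight big_cat /= big_cons add0r.
Qed.

Theorem proposition2p3 (A B : {fset int})
    (A_neq0 : A != fset0)
    (A_gt0 : forall a : int, a \in A -> 0 < a)
    (B_0 : 0 \in B)
    (minAB : 0 <= fset_min A + fset_min B) :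
  nat_submonoid (M A B).
Proof.
have A_ge0 : {in A, forall a : int, 0 <= a} by move=> a /A_gt0 /ltW.
split=> [z /(M_ge0 _ _ _ A_ge0 minAB)|]; first by case: z => // n _; exists n.
split=> [|m n]; first by apply/mem_set; right.
(* [Posz] of the sum in [nat] is by computation the sum of [Posz m] and [Posz n]. *)
by move=> /set_mem Mm /set_mem Mn; apply/mem_set; exact: (M_add A B m n).
Qed.
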